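(* Let $R$ be a semiring which lacks zero sums. If $R$ has a finite set of orthogonal primitive idempotents $\{e_1,\dots,e_m\}$ whose sum is $1_R$, then every finitely generated projective $R$-module $P$ is a finite direct sum of indecomposable projective modules, i.e., $P \cong \bigoplus_{i=1}^m (Re_i)^{n_i}$ for suitable integers $n_i\ge 0$, and this direct sum decomposition is unique (i.e., the decomposition of $P$ as an internal direct sum of indecomposable submodules is unique up to the order of the summands).
   Context: A semiring $(R,+,\cdot,0_R,1_R)$: $(R,+,0_R)$ is a commutative monoid, $(R,\cdot,1_R)$ is a (not necessarily commutative) monoid, multiplication distributes over addition, and $0_Rr=r0_R=0_R$ (so that $R$ is a left module over itself). A (left) $R$-module $V$ is a commutative monoid $(V,+,0_V)$ with scalar multiplication $R\times V\to V$ such that $r(v+w)=rv+rw$, $(r_1+r_2)v=r_1v+r_2v$, $(r_1r_2)v=r_1(r_2v)$, $1_Rv=v$, and $0_Rv=r0_V=0_V$. $R$ lacks zero sums if $a+b=0_R$ implies $a=b=0_R$. For submodules $V_1,\dots,V_n$ of $V$, $V=V_1\oplus\dots\oplus V_n$ means every element of $V$ is uniquely of the form $v_1+\dots+v_n$ with $v_i\in V_i$; a direct summand of $V$ is a submodule $T$ such that $V=T\oplus W$ for some submodule $W$. A module $V\neq\{0_V\}$ is indecomposable if there is no decomposition $V=W_1\oplus W_2$ with $W_1\ne\{0_V\}$ and $W_2\neq\{0_V\}$. A module is projective if it is a direct summand of a free $R$-module, and finitely generated projective if it is a direct summand of $R^n$ for some $n\in\mathbb{N}$. An element $e\in R$ is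 idempotent if $e^2=e$; idempotents $e,f$ are orthogonal if $ef=fe=0_R$; an idempotent is primitive if it cannot be written as the sum of two nonzero orthogonal idempotents. *)

(* Defs.v *)
From HB Require Import structures.
From mathcomp Require Import all_boot all_order all_algebra all_classical.

Set Implicit Arguments.
Unset Strict Implicit.
Unset Printing Implicit Defensive.

Import GRing.Theory.

Local Open Scope classical_set_scope.
Local Open Scope ring_scope.

Definition lacks_zero_sums (R : pzSemiRingType) : Prop :=
  forall a b : R, a + b = 0 -> a = 0 /\ b = 0.

Definition idempotent (R : pzSemiRingType) (e : R) : Prop := e * e = e.

Definition orthogonal_elements (R : pzSemiRingType) (e f : R) : Prop :=
  e * f = 0 /\ f * e = 0.

(* With this definition [0] may be primitive. *)
Definition primitive_idempotent (R : pzSemiRingType) (e : R) : Prop :=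
  idempotent e /\
  ~ exists f g : R, [/\ idempotent f, idempotent g, orthogonal_elements f g,
                        f <> 0 /\ g <> 0 & e = f + g].

Definition submodule (R : pzSemiRingType) (V : lSemiModType R) (A : set V)
  : Prop := GRing.subsemimod_closed [in A].

(* All notions below are stated for a submodule [A] of an ambient module [V],
   regarded as a module in its own right; [V] itself is [[set: V]]. *)

(* The internal direct sum decomposition of [A] into the submodules [U i];
   the empty family decomposes only the zero module. *)
Definition is_dsum (R : pzSemiRingType) (V : lSemiModType R) (I : finType)
    (A : set V) (U : I -> set V) : Prop :=
  [/\ submodule A,
      forall i, submodule (U i),
      forall i, U i `<=` A
    & forall x, A x -> exists! v : {ffun I -> V},
        (forall i, U i (v i)) /\ x = \sum_(i : I) v i].

Definition is_dsum2 (R : pzSemiRingType) (V : lSemiModType R)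
    (A T W : set V) : Prop :=
  is_dsum A (fun b : bool => if b then T else W).

Definition direct_summand (R : pzSemiRingType) (V : lSemiModType R)
    (A T : set V) : Prop :=
  exists W : set V, is_dsum2 A T W.

Definition indecomposable (R : pzSemiRingType) (V : lSemiModType R)
    (A : set V) : Prop :=
  [/\ submodule A,
      A <> [set 0]
    & ~ exists W1 W2 : set V,
        [/\ is_dsum2 A W1 W2, W1 <> [set 0] & W2 <> [set 0]]].

(* The values of [f] outside [A] are irrelevant. *)
Definition isomorphic (R : pzSemiRingType) (V V' : lSemiModType R)
    (A : set V) (B : set V') : Prop :=
  [/\ submodule A,
      submodule B
    & exists f : V -> V',
        [/\ set_bij A B f,
            forall x y, A x -> A y -> f (x + y) = f x + f y
          & forall (a : R) x, A x -> f (a *: x) = a *: f x]].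

(* [c] is the family of coordinates of [x], of finite support inside [B]. *)
Definition is_basis (R : pzSemiRingType) (F : lSemiModType R) (B : set F)
  : Prop :=
  forall x : F, exists! c : F -> R,
    [/\ finite_set [set b | c b != 0],
        [set b | c b != 0] `<=` B
      & x = \sum_(b \in [set b | c b != 0]) c b *: b].

Definition is_free (R : pzSemiRingType) (F : lSemiModType R) : Prop :=
  exists B : set F, is_basis B.

Definition projective (R : pzSemiRingType) (V : lSemiModType R) (A : set V)
  : Prop :=
  exists (F : lSemiModType R) (T : set F),
    [/\ is_free F, direct_summand [set: F] T & isomorphic A T].

Definition fg_projective (R : pzSemiRingType) (V : lSemiModType R) (A : set V)
  : Prop :=
  exists (n : nat) (T : set 'rV[R]_n),
    direct_summand [set: 'rV[R]_n] T /\ isomorphic A T.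

Definition left_ideal (R : pzSemiRingType) (e : R) : set R^o :=
  range (fun r : R => r * e : R^o).

(* The external direct sum, inside the module of all functions [I -> V]. *)
Definition ext_dsum (R : pzSemiRingType) (V : lSemiModType R) (I : finType)
    (U : I -> set V) : set {ffun I -> V} :=
  [set v | forall i, U i (v i)].

(* Main.v *)
(* When sums vanish only trivially, a direct summand [T] of [V] contains [x] and
   [y] as soon as it contains [x + y].  Hence an element of an absorbing
   submodule [C] has its coordinates in [C], and every decomposition of [V]
   restricts to one of [C].  Two decompositions into indecomposables therefore
   refine each other and coincide.  For existence, [R^n] is the direct sum of
   the copies of [R e_i] generated by the vectors [e_i *: delta_mx 0 j], each
   indecomposable or zero; each nonzero one lies in a given direct summand [T]
   of [R^n] or meets it trivially, so [T] is the sum of those it contains. *)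
Require Import Defs.
From HB Require Import structures.
From mathcomp Require Import all_boot all_order all_algebra all_classical.

Set Implicit Arguments.
Unset Strict Implicit.
Unset Printing Implicit Defensive.

Import GRing.Theory.

Local Open Scope classical_set_scope.
Local Open Scope ring_scope.

(** * Submodules, absorption and coordinates *)

Definition zero_sum_free (V : nmodType) : Prop :=
  forall x y : V, x + y = 0 -> x = 0 /\ y = 0.

(** The summand-absorbing property relative to [A]; since addition commutes, it yields [T y] as
    well. *)
Definition absorbing (V : nmodType) (A T : set V) : Prop :=
  forall x y, A x -> A y -> T (x + y) -> T x.

Section Submodules.
Variables (R : pzSemiRingType) (V : lSemiModType R).
Implicit Types (A B T W : set V).

Lemma submoduleP A : submodule A <->
  [/\ A 0, forall x y, A x -> A y -> A (x + y)
    & forall (a : R) x, A x -> A (a *: x)].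
Proof.
split=> [[[A0 AD] AZ]|[A0 AD AZ]].
  split; first by move: A0; rewrite inE.
  - by move=> x y Ax Ay; have := AD x y; rewrite !inE; apply.
  - by move=> a x Ax; have := AZ a x; rewrite !inE; apply.
split; first split.
- by rewrite inE.
- by move=> x y; rewrite !inE; apply: AD.
- by move=> a x; rewrite !inE; apply: AZ.
Qed.

Lemma submodule0 A : submodule A -> A 0.
Proof. by move/submoduleP=> []. Qed.

Lemma submoduleD A x y : submodule A -> A x -> A y -> A (x + y).
Proof. by move/submoduleP=> [_ AD _]; apply: AD. Qed.

Lemma submoduleZ A (a : R) x : submodule A -> A x -> A (a *: x).
Proof. by move/submoduleP=> [_ _ AZ]; apply: AZ. Qed.

Lemma submodule_sum A (I : finType) (P : pred I) (v : I -> V) :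
  submodule A -> (forall i, P i -> A (v i)) -> A (\sum_(i | P i) v i).
Proof.
by move=> sA Av; elim/big_ind: _ => //;
  [exact: submodule0 | move=> x y; exact: submoduleD].
Qed.

Lemma submodule_setI A B : submodule A -> submodule B -> submodule (A `&` B).
Proof.
move=> sA sB; apply/submoduleP; split.
- by split; exact: submodule0.
- by move=> x y [Ax Bx] [Ay By]; split; exact: submoduleD.
- by move=> a x [Ax Bx]; split; exact: submoduleZ.
Qed.

Lemma submodule_setT : submodule [set: V].
Proof. by apply/submoduleP. Qed.

Lemma neq_set0_ex A : submodule A -> A <> [set 0] -> exists2 x, A x & x <> 0.
Proof.
move=> sA An0; apply: contrapT => nex; apply: An0; apply/seteqP; split=> x /=.
  by move=> Ax; apply: contrapT => xn0; apply: nex; exists x.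
by move=> ->; exact: submodule0.
Qed.

(** Choosing the unique decomposition of each [x] yields a coordinate function [p]; its last clause
    encodes uniqueness, and its values outside [A] are arbitrary. *)
Lemma dsumP (I : finType) A (U : I -> set V) : is_dsum A U <->
  [/\ submodule A, forall i, submodule (U i), forall i, U i `<=` A
    & exists p : V -> I -> V,
      [/\ forall x i, A x -> U i (p x i),
          forall x, A x -> x = \sum_i p x i
        & forall v : I -> V, (forall i, U i (v i)) ->
            forall i, p (\sum_i v i) i = v i]].
Proof.
split=> [[sA sU UA dec]|[sA sU UA [p [pU pE pv]]]]; split=> //.
  have /choice [p pP] : forall x, exists v : {ffun I -> V}, A x ->
      [/\ forall i, U i (v i), x = \sum_i v i
        & forall w : {ffun I -> V},
            (forall i, U i (w i)) /\ x = \sum_i w i -> v = w].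
    move=> x; have [Ax|nAx] := pselect (A x); last by exists [ffun=> 0].
    by have [v [[vU vE] vu]] := dec _ Ax; exists v.
  exists (fun x => p x); split.
  - by move=> x i Ax; have [] := pP _ Ax.
  - by move=> x Ax; have [] := pP _ Ax.
  - move=> v vU i; have Av : A (\sum_i v i).
      by apply: submodule_sum => // j _; apply: UA.
    have [_ _ /(_ (finfun v)) ->] := pP _ Av; first by rewrite ffunE.
    split=> [j|]; first by rewrite ffunE.
    by apply: eq_bigr => j _; rewrite ffunE.
move=> x Ax; exists [ffun i => p x i]; split.
  split=> [i|]; first by rewrite ffunE; exact: pU.
  by rewrite {1}(pE _ Ax); apply: eq_bigr => i _; rewrite ffunE.
by move=> v [vU vE]; apply/ffunP=> i; rewrite ffunE vE pv.
Qed.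

Lemma dsum2_intro A T W : submodule A -> submodule T -> submodule W ->
  T `<=` A -> W `<=` A ->
  forall p q : V -> V,
  (forall x, A x -> [/\ T (p x), W (q x) & x = p x + q x]) ->
  (forall t w, T t -> W w -> p (t + w) = t /\ q (t + w) = w) ->
  is_dsum2 A T W.
Proof.
move=> sA sT sW TA WA p q pq1 pq2; apply/dsumP; split=> //; try by case.
exists (fun x b => if b then p x else q x); split.
- by move=> x [] /pq1[].
- by move=> x /pq1[_ _]; rewrite big_bool.
- move=> v vU b; rewrite big_bool.
  by have [] := pq2 _ _ (vU true) (vU false); case: b.
Qed.

Lemma dsum2P A T W : is_dsum2 A T W ->
  [/\ submodule A, submodule T, submodule W & T `<=` A /\ W `<=` A] /\
  exists p q : V -> V,
  (forall x, A x -> [/\ T (p x), W (q x) & x = p x + q x]) /\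
  (forall t w, T t -> W w -> p (t + w) = t /\ q (t + w) = w).
Proof.
case/dsumP=> sA sU UA [p [pU pE pv]]; split.
  by split=> //; [exact: (sU true)|exact: (sU false)|
    split; [exact: (UA true)|exact: (UA false)]].
exists (p^~ true), (p^~ false); split=> [x Ax|t w Tt Ww].
  split; [exact: (pU _ true)|exact: (pU _ false)|].
  by rewrite {1}(pE _ Ax) big_bool.
have vU b : (if b then T else W) (if b then t else w) by case: b.
by have := pv _ vU; rewrite big_bool => h; rewrite (h true) (h false).
Qed.

(** * Restricting, splitting and reindexing a direct sum *)

Section DirectSum.
Variables (I : finType) (A : set V) (U : I -> set V).

(** Uniqueness forces linearity of the coordinates: both sides of each identity are coordinates of
    the same sum. *)
Lemma dsum_coord : is_dsum A U -> exists p : V -> I -> V,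
  [/\ forall x i, A x -> U i (p x i),
      forall x, A x -> x = \sum_i p x i
    & forall v : I -> V, (forall i, U i (v i)) ->
        forall i, p (\sum_i v i) i = v i] /\
  [/\ forall i x j, U i x -> p x j = if j == i then x else 0,
      forall x y i, A x -> A y -> p (x + y) i = p x i + p y i
    & forall (a : R) x i, A x -> p (a *: x) i = a *: p x i].
Proof.
case/dsumP=> sA sU UA [p [pU pE pv]]; exists p; split; split=> //.
- move=> i x j Ux; have {1}-> : x = \sum_k if k == i then x else 0.
    by rewrite -big_mkcond big_pred1_eq.
  rewrite pv // => k; case: eqP => [->|_] //; exact: submodule0.
- move=> x y i Ax Ay; rewrite [in LHS](pE _ Ax) [in LHS](pE _ Ay) -big_split.
  by rewrite pv // => k; apply: submoduleD => //; exact: pU.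
- move=> a x i Ax; rewrite [in LHS](pE _ Ax) scaler_sumr pv // => k.
  by apply: submoduleZ => //; exact: pU.
Qed.

Lemma dsum_disjoint i j x : is_dsum A U -> i <> j -> U i x -> U j x -> x = 0.
Proof.
case/dsum_coord=> p [_ [p1 _ _]] ij Uix Ujx.
have := p1 j x j Ujx; rewrite eqxx (p1 i) //.
by case: eqP => // ji; case: ij.
Qed.

(* The coordinates of [x] and [y] outside [i] add up to zero, hence vanish. *)
Lemma dsum_absorbing i : zero_sum_free V -> is_dsum A U -> absorbing A (U i).
Proof.
move=> zV /dsum_coord[p [[pU pE _] [p1 pD _]]] x y Ax Ay Uxy.
have p0 k : k != i -> p x k = 0.
  move=> ki; have [//|->//] := zV (p x k) (p y k).
  by rewrite -pD // (p1 i) // (negbTE ki).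
by rewrite (pE _ Ax) (bigD1 i) //= big1 ?addr0 //; exact: pU.
Qed.

(** A coordinate of [x] is one of two summands of [x], the other being the sum of the remaining
    coordinates, so absorption keeps it in [T] and the same [p] serves for [T]. *)
Lemma dsum_setI T : is_dsum A U -> submodule T -> T `<=` A -> absorbing A T ->
  is_dsum T (fun i => T `&` U i).
Proof.
case/dsumP=> sA sU UA [p [pU pE pv]] sT TA aT; apply/dsumP; split=> //.
  by move=> i; exact: submodule_setI.
exists p; split.
- move=> x i Tx; have Ax := TA _ Tx; split; last exact: pU.
  apply: (aT _ (\sum_(j | j != i) p x j)); first exact/UA/pU.
    by apply: submodule_sum => // j _; exact/UA/pU.
  by move: Tx; rewrite {1}(pE _ Ax) (bigD1 i).
- by move=> x /TA; exact: pE.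
- by move=> v vU; apply: pv => i; case: (vU i).
Qed.

(** Some [U i] is nonzero because [A] is. Grouping the other summands into one complement gives a
    binary decomposition, so that complement vanishes. *)
Lemma dsum_indecomposable : is_dsum A U -> indecomposable A ->
  exists i, U i = A /\ forall j, j <> i -> U j = [set 0].
Proof.
move=> dU [sA An0 nex].
have [_ sU UA _] := dU.
have [p [[pU pE _] [p1 pD pZ]]] := dsum_coord dU.
have [i Uin0] : exists i, U i <> [set 0].
  apply: contrapT => Ui0; have [x Ax xn0] := neq_set0_ex sA An0.
  apply: xn0; rewrite (pE _ Ax) big1 // => i _.
  have : U i (p x i) by exact: pU.
  by have -> : U i = [set 0] by apply: contrapT => h; apply: Ui0; exists i.
(* The complement of [U i], described as the kernel of the [i]-th coordinate. *)
pose W := [set x | A x /\ p x i = 0].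
have sW : submodule W.
  apply/submoduleP; split.
  - by split; rewrite ?(p1 i) ?if_same //; exact: submodule0.
  - by move=> x y [Ax x0] [Ay y0]; split; [exact: submoduleD |
      rewrite pD // x0 y0 addr0].
  - by move=> a x [Ax x0]; split; [exact: submoduleZ |
      rewrite pZ // x0 scaler0].
have UW j : j <> i -> U j `<=` W.
  move=> ji x Ujx; split; first exact: (UA j).
  by rewrite (p1 j) //; case: eqP => // ij; case: ji.
have dW : is_dsum2 A (U i) W.
  have qW x : A x -> W (\sum_(j | j != i) p x j).
    by move=> Ax; apply: submodule_sum => // j /eqP /UW; apply; exact: pU.
  apply: (@dsum2_intro A (U i) W _ _ _ _ _ (p^~ i)
            (fun x => \sum_(j | j != i) p x j)) => //.
  - by move=> x [].
  - move=> x Ax; split; [exact: pU | exact: qW |].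
    by rewrite {1}(pE _ Ax) (bigD1 i).
  - move=> t w Ut [Aw w0]; have At := UA _ _ Ut; split.
      by rewrite pD // w0 addr0 (p1 i) // eqxx.
    rewrite [RHS](pE _ Aw) [RHS](bigD1 i) //= w0 add0r.
    by apply: eq_bigr => j ji; rewrite pD // (p1 i) // (negbTE ji) add0r.
have W0 : W = [set 0].
  by apply: contrapT => Wn0; apply: nex; exists (U i), W.
exists i; split.
  apply/seteqP; split=> [|x Ax]; first exact: UA.
  rewrite (pE _ Ax) (bigD1 i) //= big1 ?addr0; first exact: pU.
  move=> j /eqP ji; have : W (p x j) by apply: (UW j) => //; exact: pU.
  by rewrite W0.
move=> j ji; apply/seteqP; split=> x /=.
  by move/(UW _ ji); rewrite W0.
by move=> ->; exact: submodule0.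
Qed.

(** This serves to discard zero summands and to change the index type of the others. *)
Lemma dsum_reindex (J : finType) (h : J -> I) : is_dsum A U -> injective h ->
  (forall i, (forall j, h j <> i) -> U i = [set 0]) ->
  is_dsum A (U \o h).
Proof.
case/dsumP=> sA sU UA [p [pU pE pv]] hI U0; apply/dsumP; split=> //=.
exists (fun x j => p x (h j)); split.
- by move=> x j Ax; exact: pU.
- move=> x Ax; rewrite {1}(pE _ Ax).
  rewrite [RHS](partition_big h predT) //=; apply: eq_bigr => i _.
  have [[j hj]|hi] := pselect (exists j, h j = i).
    rewrite (big_pred1 j) ?hj // => k /=.
    by rewrite -hj (inj_eq hI).
  rewrite big_pred0 => [|j]; last by apply/eqP => hj; apply: hi; exists j.
  have : U i (p x i) by exact: pU.
  by rewrite U0 // => j hj; apply: hi; exists j.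
(* [w] extends [v] to all of [I]: a fibre of [h] has at most one element, and an empty fibre
   contributes 0. *)
- move=> v vU j; pose w i := \sum_(j | h j == i) v j.
  have -> : \sum_j v j = \sum_i w i by exact: partition_big.
  rewrite pv /w => [|i].
    by rewrite (big_pred1 j) // => k /=; rewrite (inj_eq hI).
  by apply: submodule_sum => // k /eqP <-; exact: vU.
Qed.

End DirectSum.

(** * Uniqueness of decompositions into indecomposables *)

(** As [U i] is absorbing, the decomposition [W] restricts to it; by indecomposability a single
    [U i] [&] [W j] is all of [U i]. *)
Lemma dsum_sub (k l : nat) A (U : 'I_k -> set V) (W : 'I_l -> set V) :
  zero_sum_free V -> is_dsum A U -> (forall i, indecomposable (U i)) ->
  is_dsum A W -> exists s : 'I_k -> 'I_l, forall i, U i `<=` W (s i).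
Proof.
move=> zV dU iU dW; suff /choice[s sP] : forall i, exists j, U i `<=` W j.
  by exists s.
move=> i; have [sA sU UA _] := dU.
have dI := dsum_setI dW (sU i) (UA i) (dsum_absorbing (i:=i) zV dU).
have [j [UW _]] := dsum_indecomposable dI (iU i).
by exists j; rewrite -UW => x [].
Qed.

(** The inclusions in both directions give maps [s] and [t] with [U i] inside [U (t (s i))].
    Distinct summands meet only in 0 and each is nonzero, so [s] and [t] are mutually inverse and
    the inclusions are equalities. *)
Lemma dsum_unique (k l : nat) A (U : 'I_k -> set V) (W : 'I_l -> set V) :
  zero_sum_free V -> is_dsum A U -> (forall i, indecomposable (U i)) ->
  is_dsum A W -> (forall j, indecomposable (W j)) ->
  exists s : 'I_k -> 'I_l, bijective s /\ forall i, U i = W (s i).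
Proof.
move=> zV dU iU dW iW.
have [s sP] := dsum_sub zV dU iU dW.
have [t tP] := dsum_sub zV dW iW dU.
have cancel_sub n (X : 'I_n -> set V) i j : is_dsum A X ->
    (forall i, indecomposable (X i)) -> X i `<=` X j -> j = i.
  move=> dX iX Xij; apply: contrapT => ji; have [sX Xn0 _] := iX i.
  have [x Xx] := neq_set0_ex sX Xn0; apply.
  by apply: (dsum_disjoint dX ji) => //; exact: Xij.
have ts i : t (s i) = i.
  by apply: (cancel_sub _ U) => // x /sP /tP.
exists s; split.
  by exists t => // j; apply: (cancel_sub _ W) => // x /tP /sP.
move=> i; apply/seteqP; split; first exact: sP.
by rewrite -{2}[i]ts; exact: tP.
Qed.

(** * Cyclic submodules generated by idempotent-like elements *)

(* The element [u] generates a copy of [R e], with [u] in the role of [e]. *)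
Definition generates_ideal (e : R) (u : V) : Prop :=
  e *: u = u /\ forall a b : R, a *: u = b *: u -> a * e = b * e.

Definition cyclic (u : V) : set V := range (fun a : R => a *: u).

Lemma submodule_cyclic u : submodule (cyclic u).
Proof.
apply/submoduleP; split.
- by exists 0; rewrite ?scale0r.
- by move=> _ _ [a _ <-] [b _ <-]; exists (a + b); rewrite ?scalerDl.
- by move=> a _ [b _ <-]; exists (a * b); rewrite ?scalerA.
Qed.

Lemma cyclic_id u : cyclic u u.
Proof. by exists 1; rewrite ?scale1r. Qed.

(* A splitting [u = x + y] along a decomposition of [cyclic u] comes from a
   splitting of [e] into two orthogonal idempotents. *)
Lemma cyclic_indecomposable (e : R) (u : V) :
  generates_ideal e u -> primitive_idempotent e -> e <> 0 ->
  indecomposable (cyclic u).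
Proof.
move=> [eu ue] [ee eprim] en0; split; first exact: submodule_cyclic.
  move=> u0; apply: en0; have := cyclic_id u; rewrite u0 /= => u00.
  by rewrite -ee -[RHS](mul0r e); apply: ue; rewrite u00 !scaler0.
case=> W1 [W2 [/dsum2P[[_ sW1 sW2 [W1u W2u]] [p [q [pq pqE]]]] W1n0 W2n0]].
have [W1p W2q uE] := pq _ (cyclic_id u).
have [a0 _ pE0] := W1u _ W1p; have [b0 _ qE0] := W2u _ W2q.
set x := p u in W1p uE pE0; set y := q u in W2q uE qE0.
(* The coefficients [a0] and [b0] are not determined by [x] and [y]. Multiplying by [e] normalizes
   them, so that identities between [f] and [g] can be tested on [u] through [ue]. *)
pose f := a0 * e; pose g := b0 * e.
have fE : f *: u = x by rewrite /f -scalerA eu.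
have gE : g *: u = y by rewrite /g -scalerA eu.
have fe : f * e = f by rewrite /f -mulrA ee.
have ge : g * e = g by rewrite /g -mulrA ee.
have split_inj t w t' w' : W1 t -> W2 w -> W1 t' -> W2 w' ->
    t + w = t' + w' -> t = t' /\ w = w'.
  move=> ht hw ht' hw' E; have [pt qw] := pqE _ _ ht hw.
  by have [pt' qw'] := pqE _ _ ht' hw'; rewrite -{1}pt -{2}qw E pt' qw'.
(* Since [f *: u = x] and [g *: u = y], applying [f] and [g] to [u = x + y] and comparing components
   shows that they act on [x] and [y] as the two projections. *)
have fxy : f *: x + f *: y = x + 0 by rewrite -scalerDr -uE fE addr0.
have gxy : g *: x + g *: y = 0 + y by rewrite -scalerDr -uE gE add0r.
have [fx fy] : f *: x = x /\ f *: y = 0.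
  by apply: split_inj fxy; do ?[exact: submoduleZ | exact: submodule0].
have [gx gy] : g *: x = 0 /\ g *: y = y.
  by apply: split_inj gxy; do ?[exact: submoduleZ | exact: submodule0].
have ff : f * f = f.
  rewrite -{2}fe mulrA -[RHS]fe; apply: ue.
  by rewrite -scalerA fE fx.
have gg : g * g = g.
  rewrite -{2}ge mulrA -[RHS]ge; apply: ue.
  by rewrite -scalerA gE gy.
have fg : f * g = 0.
  rewrite -ge mulrA -[RHS](mul0r e); apply: ue.
  by rewrite -scalerA gE fy scale0r.
have gf : g * f = 0.
  rewrite -fe mulrA -[RHS](mul0r e); apply: ue.
  by rewrite -scalerA fE gx scale0r.
have efg : e = f + g.
  rewrite -{1}ee -fe -ge -mulrDl; apply: ue.
  by rewrite eu scalerDl fE gE.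
(* If [f] or [g] vanishes, [u] lies in one of the two parts; that part is then everything and the
   other one is zero. *)
have trivial_part (Wa Wb : set V) : submodule Wb ->
    Wa `<=` cyclic u -> Wb u -> (forall z, Wa z -> Wb z -> z = 0) -> Wa 0 ->
    Wa = [set 0].
  move=> sWb Wau Wbu disj Wa0; apply/seteqP; split=> z /=; last by move->.
  move=> Waz; apply: disj => //; have [a _ <-] := Wau _ Waz.
  exact: submoduleZ.
have disj z : W1 z -> W2 z -> z = 0.
  move=> z1 z2; have z0 : z + 0 = 0 + z by rewrite addr0 add0r.
  by have [] := split_inj z 0 0 z z1 (submodule0 sW2) (submodule0 sW1) z2 z0.
apply: eprim; exists f, g; split=> //; split=> [f0|g0].
- apply: W1n0; apply: (trivial_part W1 W2) => //; last exact: submodule0.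
  by rewrite uE -fE f0 scale0r add0r.
- apply: W2n0; apply: (trivial_part W2 W1) => //; last exact: submodule0.
    by rewrite uE -gE g0 scale0r addr0.
  by move=> z z2 z1; exact: disj.
Qed.

End Submodules.

(** * The left ideals [R e]: isomorphic copies and projectivity *)

Lemma submodule_left_ideal (R : pzSemiRingType) (e : R) :
  submodule (left_ideal e).
Proof.
apply/submoduleP; split.
- by exists 0; rewrite ?mul0r.
- by move=> _ _ [a _ <-] [b _ <-]; exists (a + b); rewrite ?mulrDl.
- by move=> a _ [b _ <-]; exists (a * b) => //; rewrite -mulrA.
Qed.

Lemma cyclic_isomorphic (R : pzSemiRingType) (V : lSemiModType R)
    (e : R) (u : V) :
  generates_ideal e u -> isomorphic (cyclic u) (left_ideal e).
Proof.
move=> [eu ue]; split; [exact: submodule_cyclic|exact: submodule_left_ideal|].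
(* The coefficient [f x] is an arbitrary choice, but [f x * e] does not depend on it; this product
   is the isomorphism. *)
have /choice [f fP] : forall x, exists r : R, cyclic u x -> x = r *: u.
  move=> x; have [[a _ <-]|nx] := pselect (cyclic u x); first by exists a.
  by exists 0.
have fE (a : R) : f (a *: u) * e = a * e.
  by apply: ue; rewrite -fP //; exists a.
exists (fun x => f x * e); split.
- split.
  + by move=> x _; exists (f x).
  + move=> x y; rewrite !inE => cx cy E; rewrite (fP _ cx) (fP _ cy).
    by rewrite -[u]eu !scalerA E.
  + by move=> _ [a _ <-]; exists (a *: u); [exists a | exact: fE].
- move=> _ _ [a _ <-] [b _ <-].
  by rewrite -scalerDl !fE mulrDl.
- by move=> a _ [b _ <-]; rewrite scalerA !fE -mulrA.
Qed.


Lemma is_free_regular (R : pzSemiRingType) : is_free R^o.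
Proof.
(* The support can be empty, as for [x = 0], so the sum is widened to the singleton of 1. *)
have sumE (c : R^o -> R) : [set b | c b != 0] `<=` [set 1] ->
    \sum_(b \in [set b | c b != 0]) c b *: b = c 1.
  move=> c1; rewrite (fsbig_widen _ [set 1]) // => [|b /= [_]].
    by rewrite fsbig_set1 /= /GRing.scale /= mulr1.
  by move/negP; rewrite negbK => /eqP ->; rewrite scale0r.
exists [set 1] => x; exists (fun b => if b == 1 then x else 0); split.
  have sub1 : [set b : R^o | (if b == 1 then x : R else 0) != 0] `<=` [set 1].
    by move=> b /=; have [->//|_] := eqVneq b 1; rewrite eqxx.
  split=> //; first exact: sub_finite_set sub1 (finite_set1 _).
  by rewrite sumE // eqxx.
move=> c [_ c1 ->]; rewrite sumE //; apply/funext => b.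
case: eqP => [->//|b1]; apply/esym/eqP; apply: contrapT => /negP cb.
by case: b1; exact: c1.
Qed.

(** Right multiplications by [e] and [f] are the projections of [R] onto [R e] and [R f], which
    makes [R e] a summand of the free module [R]. *)
Lemma left_ideal_projective (R : pzSemiRingType) (V : lSemiModType R)
    (A : set V) (e f : R) :
  Defs.idempotent e -> Defs.idempotent f -> orthogonal_elements e f ->
  e + f = 1 ->
  isomorphic A (left_ideal e) -> projective A.
Proof.
move=> ee ff [ef fe] ef1 iso; exists R^o, (left_ideal e); split=> //.
  exact: is_free_regular.
exists (left_ideal f).
apply: (@dsum2_intro R R^o _ _ _ _ _ _ _ _
  (fun x => x * e : R^o) (fun x => x * f : R^o)) => //.
- exact: submodule_setT.
- exact: submodule_left_ideal.
- exact: submodule_left_ideal.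
- move=> x _; split; [by exists x | by exists x |].
  by rewrite -mulrDr ef1 mulr1.
- move=> _ _ [a _ <-] [b _ <-].
  suff: (a * e + b * f) * e = a * e /\ (a * e + b * f) * f = b * f by [].
  by rewrite !mulrDl -!mulrA ee ff ef fe !mulr0 addr0 add0r.
Qed.

(** Without subtraction, the sum of the other idempotents stands in for [1 - e i]. Its idempotence
    follows from [f = (e i + f) * f = f * f]. *)
Lemma orthogonal_complement (R : pzSemiRingType) (m : nat) (e : 'I_m -> R)
    (i : 'I_m) :
  (forall i, Defs.idempotent (e i)) ->
  (forall i j, i <> j -> orthogonal_elements (e i) (e j)) ->
  \sum_(i < m) e i = 1 ->
  exists f, [/\ Defs.idempotent f, orthogonal_elements (e i) f & e i + f = 1].
Proof.
move=> ee eo e1; exists (\sum_(j | j != i) e j).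
have ef : e i * (\sum_(j | j != i) e j) = 0.
  rewrite mulr_sumr big1 // => j /eqP ji.
  by have [] := eo _ _ ji.
have fe : (\sum_(j | j != i) e j) * e i = 0.
  rewrite mulr_suml big1 // => j /eqP ji.
  by have [] := eo _ _ ji.
have ef1 : e i + \sum_(j | j != i) e j = 1.
  by rewrite -e1 [RHS](bigD1 i).
split=> //.
by rewrite /Defs.idempotent -{3}[\sum_(j | j != i) e j]mul1r -ef1 mulrDl ef
  add0r.
Qed.

(** * Transport of direct sums along isomorphisms *)

Section Transport.
Variables (R : pzSemiRingType) (V V' : lSemiModType R).

Lemma dsum_isomorphic (I : finType) (A : set V) (U : I -> set V)
    (B : I -> set V') :
  is_dsum A U -> (forall i, isomorphic (U i) (B i)) ->
  isomorphic A (ext_dsum B).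
Proof.
move=> dU iso.
have [f fP] := choice (fun i => let: And3 _ _ h := iso i in h).
have sB i : submodule (B i) by have [] := iso i.
have [sA sU UA _] := dU.
have [p [[pU pE pv] [_ pD pZ]]] := dsum_coord dU.
have fB i x : U i x -> B i (f i x).
  by have [[fun_f _ _] _ _] := fP i; exact: fun_f.
split=> //.
  apply/submoduleP; split.
  - by move=> i; rewrite ffunE; exact: submodule0.
  - by move=> v w Bv Bw i; rewrite ffunE; exact: submoduleD.
  - by move=> a v Bv i; rewrite ffunE; exact: submoduleZ.
exists (fun x => [ffun i => f i (p x i)]); split.
- split.
  + by move=> x Ax i; rewrite ffunE; apply/fB/pU.
  + move=> x y; rewrite !inE => Ax Ay /ffunP E.
    rewrite (pE _ Ax) (pE _ Ay); apply: eq_bigr => i _.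
    have [[_ injf _] _ _] := fP i; apply: injf.
    * by rewrite inE; exact: pU.
    * by rewrite inE; exact: pU.
    * by have := E i; rewrite !ffunE.
  + move=> v Bv.
    have /choice [g gP] : forall i, exists x, U i x /\ f i x = v i.
      move=> i; have [[_ _ surj] _ _] := fP i.
      by have [x Ux fx] := surj _ (Bv i); exists x.
    exists (\sum_i g i).
      by apply: submodule_sum => // i _; apply: (UA i); case: (gP i).
    apply/ffunP=> i; rewrite ffunE; have [_ <-] := gP i; congr (f i _).
    by apply: pv => j; case: (gP j).
- move=> x y Ax Ay; apply/ffunP=> i; rewrite !ffunE pD //.
  by have [_ fD _] := fP i; apply: fD; exact: pU.
- move=> a x Ax; apply/ffunP=> i; rewrite !ffunE pZ //.
  by have [_ _ fZ] := fP i; apply: fZ; exact: pU.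
Qed.

Lemma dsum_preimage (I : finType) (f : V -> V') (T : set V')
    (U : I -> set V') :
  set_bij [set: V] T f -> {morph f : x y / x + y} ->
  (forall a : R, {morph f : x / a *: x}) -> is_dsum T U ->
  is_dsum [set: V] (fun i => f @^-1` U i).
Proof.
move=> [fT finj fsurj] fD fZ /dsumP[sT sU UT [p [pU pE pv]]].
have injf x y : f x = f y -> x = y by apply: finj; rewrite inE.
have f0 : f 0 = 0 by rewrite -[0 in LHS](scale0r 0) fZ scale0r.
have f_sum (v : I -> V) : f (\sum_i v i) = \sum_i f (v i).
  exact: (big_morph f fD f0).
have Tf x : T (f x) by exact: fT.
have /choice [g gP] : forall y, exists x, T y -> f x = y.
  move=> y; have [/fsurj[x _ <-]|nTy] := pselect (T y); first by exists x.
  by exists 0.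
have fg x i : f (g (p (f x) i)) = p (f x) i.
  by rewrite gP //; apply: (UT i); exact: pU.
apply/dsumP; split=> //.
- exact: submodule_setT.
- move=> i; apply/submoduleP; split=> [|x y Ux Uy|a x Ux] /=.
  + by rewrite f0; exact: submodule0.
  + by rewrite fD; exact: submoduleD.
  + by rewrite fZ; exact: submoduleZ.
exists (fun x i => g (p (f x) i)); split.
- by move=> x i _ /=; rewrite fg; exact: pU.
- by move=> x _; apply: injf; rewrite f_sum [LHS](pE (f x)) //; apply: eq_bigr.
- move=> v vU i; apply: injf; rewrite fg f_sum.
  exact: (pv (fun i => f (v i))).
Qed.

End Transport.

(** * Direct summands of a decomposed module *)

Section Summands.
Variables (R : pzSemiRingType) (V : lSemiModType R) (A T : set V).
Hypotheses (zV : zero_sum_free V) (AT : direct_summand A T).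

(** The decomposition of [A] into [T] and a complement restricts to the absorbing [C], and
    indecomposability leaves only one of the two intersections nonzero. *)
Lemma summand_dichotomy (C : set V) : submodule C -> C `<=` A ->
  absorbing A C -> indecomposable C -> C `<=` T \/ T `&` C = [set 0].
Proof.
case: AT => W dTW sC CA aC iC.
have [[] [CT C0]] := dsum_indecomposable (dsum_setI dTW sC CA aC) iC.
  by left; rewrite -CT => x [].
by right; rewrite setIC; exact: (C0 true).
Qed.

(** [T] is absorbing, hence the direct sum of its intersections with the [U i]. By the dichotomy
    each of these is [U i] or zero, and [h] enumerates the nonzero ones. *)
Lemma dsum_summand (I J : finType) (U : I -> set V) (h : J -> I) :
  is_dsum A U -> (forall i, U i = [set 0] \/ indecomposable (U i)) ->
  injective h -> (forall j, U (h j) `<=` T) ->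
  (forall i, U i <> [set 0] -> U i `<=` T -> exists j, h j = i) ->
  is_dsum T (U \o h).
Proof.
move=> dU iU hI hT hS; case: (AT) => W dTW.
have [[_ sT _ [TA _]] _] := dsum2P dTW.
have aT : absorbing A T by exact: (@dsum_absorbing _ _ _ _ _ true zV dTW).
have [_ sU UA _] := dU.
have -> : U \o h = (fun i => T `&` U i) \o h.
  by apply/funext => j /=; apply/esym/setIidr; exact: hT.
apply: dsum_reindex => //; first exact: dsum_setI dU sT TA aT.
move=> i hi; have T0 : T 0 by exact: submodule0.
have [Ui0|iUi] := iU i.
  by rewrite Ui0; apply/seteqP; split=> [x []//|x /= ->].
have [UT|//] := summand_dichotomy (sU i) (UA i) (dsum_absorbing zV dU) iUi.
have [||j hj] := hS i; [by case: iUi | by [] | by case: (hi j)].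
Qed.

End Summands.

(** * The decomposition of [R^n] induced by the idempotents *)

Section StandardModule.
Variables (R : pzSemiRingType) (m n : nat) (e : 'I_m -> R).
Hypotheses (ee : forall i, Defs.idempotent (e i))
  (eo : forall i j, i <> j -> orthogonal_elements (e i) (e j))
  (e1 : \sum_(i < m) e i = 1).

Definition std_gen (k : 'I_m * 'I_n) : 'rV[R]_n :=
  e k.1 *: delta_mx 0 k.2.

Lemma std_gen_generates k : generates_ideal (e k.1) (std_gen k).
Proof.
split=> [|a b]; first by rewrite scalerA ee.
rewrite /std_gen !scalerA => /(congr1 (fun x : 'rV__ => x 0 k.2)).
by rewrite !mxE !eqxx !mulr1.
Qed.

Lemma dsum_std : is_dsum [set: 'rV[R]_n] (fun k => cyclic (std_gen k)).
Proof.
apply/dsumP; split=> //.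
- exact: submodule_setT.
- by move=> k; exact: submodule_cyclic.
exists (fun (x : 'rV[R]_n) k => x 0 k.2 *: std_gen k); split.
- by move=> x k _; exists (x 0 k.2).
- move=> x _; apply/rowP=> j; rewrite summxE.
  rewrite -(pair_bigA _ (fun i k => (x 0 k *: std_gen (i, k)) 0 j)) /=.
  rewrite -[LHS]mulr1 -e1 mulr_sumr; apply: eq_bigr => i _.
  rewrite (bigD1 j) //= big1 ?addr0 => [|k kj].
    by rewrite !mxE !eqxx mulr1.
  by rewrite !mxE eq_sym (negbTE kj) andbF !mulr0.
- move=> v vU k.
  have /choice [a aP] : forall l, exists b, v l = b *: std_gen l.
    by move=> l; have [b _ <-] := vU l; exists b.
  (* The generator absorbs [e k.1], so only entries multiplied on the right by [e k.1] are compared;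
     orthogonality then kills the other terms in the same column. *)
  rewrite [RHS]aP -(std_gen_generates k).1 !scalerA; congr (_ *: _).
  rewrite summxE mulr_suml (bigD1 k) //= big1 ?addr0 => [|l lk].
    by rewrite aP !mxE !eqxx mulr1 -!mulrA !ee.
  rewrite aP !mxE -!mulrA; case: (eqVneq k.2 l.2) => kl; last first.
    by rewrite andbF !(mulr0, mul0r).
  rewrite eqxx mul1r; have [|-> _] := @eo l.1 k.1; last by rewrite mulr0.
  by move=> lk1; case/eqP: lk; case: (l) (k) kl lk1 => ? ? [? ?] /= -> ->.
Qed.

End StandardModule.

(** * Decomposition of finitely generated projective modules *)

Lemma zero_sum_free_row (R : pzSemiRingType) (n : nat) :
  lacks_zero_sums R -> zero_sum_free 'rV[R]_n.
Proof.
move=> hR x y xy0.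
have xy j : x 0 j = 0 /\ y 0 j = 0.
  by apply: hR; have := congr1 (fun z : 'rV__ => z 0 j) xy0; rewrite !mxE.
by split; apply/rowP=> j; rewrite mxE; case: (xy j).
Qed.

Theorem corollary3p4 (R : pzSemiRingType) (hR : lacks_zero_sums R)
    (m : nat) (e : 'I_m -> R)
    (e_prim : forall i, primitive_idempotent (e i))
    (e_orth : forall i j, i <> j -> orthogonal_elements (e i) (e j))
    (e_sum : \sum_(i < m) e i = 1)
    (P : lSemiModType R) (hP : fg_projective [set: P]) :
  (exists n : 'I_m -> nat,
     isomorphic [set: P]
       (ext_dsum (fun k : {i : 'I_m & 'I_(n i)} => left_ideal (e (tag k)))) /\
     exists W : {i : 'I_m & 'I_(n i)} -> set P,
       is_dsum [set: P] W /\
       forall k, [/\ indecomposable (W k),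
                     projective (W k)
                   & isomorphic (W k) (left_ideal (e (tag k)))]) /\
  (forall (k l : nat) (V : 'I_k -> set P) (W : 'I_l -> set P),
     is_dsum [set: P] V -> (forall i, indecomposable (V i)) ->
     is_dsum [set: P] W -> (forall j, indecomposable (W j)) ->
     exists s : 'I_k -> 'I_l, bijective s /\ forall i, V i = W (s i)).
Proof.
have [n [T [dT [_ _ [f [fbij fD fZ]]]]]] := hP.
have zV := @zero_sum_free_row R n hR.
have {}fD : {morph f : x y / x + y} by move=> x y; exact: fD.
have {}fZ (a : R) : {morph f : x / a *: x} by move=> x; exact: fZ.
have injf x y : f x = f y -> x = y.
  by have [_ finj _] := fbij; apply: finj; rewrite inE.
have f0 : f 0 = 0 by rewrite -[0 in LHS](scale0r 0) fZ scale0r.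
(* [P] inherits the property from [R^n] through the injective linear map [f]. *)
have zP : zero_sum_free P.
  move=> x y xy0; have [|fx fy] := zV (f x) (f y); first by rewrite -fD xy0.
  by split; apply: injf; rewrite f0.
split; last by move=> k l V W; exact: dsum_unique.
have ee i : Defs.idempotent (e i) by case: (e_prim i).
pose u := @std_gen R m n e.
have ug k : generates_ideal (e k.1) (u k) by exact: std_gen_generates.
have dU : is_dsum [set: 'rV[R]_n] (fun k => cyclic (u k)) by exact: dsum_std.
have u0 k : e k.1 = 0 -> cyclic (u k) = [set 0].
  move=> ek0; rewrite /u /std_gen ek0 scale0r.
  apply/seteqP; split=> [_ [a _ <-]|_ ->] /=; first exact: scaler0.
  exact: cyclic_id.
have iU k : e k.1 <> 0 -> indecomposable (cyclic (u k)).
  exact: cyclic_indecomposable.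
(* The multiplicity of [R e_i] is the number of its copies inside [T]. The condition [e i <> 0]
   matters because 0 may count as primitive; such an index gets multiplicity 0. *)
pose S i := [set j : 'I_n | `[< e i <> 0 /\ cyclic (u (i, j)) `<=` T >]]%SET.
pose h (k : {i : 'I_m & 'I_#|S i|}) : 'I_m * 'I_n :=
  (tag k, enum_val (tagged k)).
have hI : injective h.
  move=> [i q] [i' q'] [/= ii']; case: i' / ii' q' => q'.
  by move/enum_val_inj ->.
have hinT k : e (tag k) <> 0 /\ cyclic (u (h k)) `<=` T.
  by have := enum_valP (tagged k); rewrite inE => /asboolP.
have dTh : is_dsum T ((fun k => cyclic (u k)) \o h).
  apply: (dsum_summand zV dT dU) => //.
  - by move=> k; have [/u0|/iU] := pselect (e k.1 = 0); [left|right].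
  - by move=> k; case: (hinT k).
  - move=> [i j] Un0 UT.
    have Sj : j \in S i.
      by rewrite inE; apply/asboolP; split=> // ei0; apply: Un0; exact: u0.
    exists (Tagged (fun i => 'I_#|S i|) (enum_rank_in Sj j)).
    by rewrite /h /= enum_rankK_in.
(* The generators found in [T] are pulled back to [P], where they generate copies of the same left
   ideals. *)
have /choice [w wP] : forall k, exists x, f x = u (h k).
  move=> k; have [_ _ fsurj] := fbij; have [_ hT] := hinT k.
  by have [x _ fx] := fsurj _ (hT _ (cyclic_id _)); exists x.
have wg k : generates_ideal (e (tag k)) (w k).
  have [eu ue] := ug (h k); split=> [|a b ab].
    by apply: injf; rewrite fZ wP.
  by apply: ue; rewrite -wP -!fZ ab.
have dW : is_dsum [set: P] (fun k => cyclic (w k)).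
  suff -> : (fun k => cyclic (w k)) = (fun k => f @^-1` cyclic (u (h k))).
    exact: dsum_preimage fbij fD fZ dTh.
  apply/funext=> k; apply/seteqP; split=> [_ [a _ <-]|x [a _ ax]].
    by exists a; rewrite // fZ wP.
  by exists a => //; apply: injf; rewrite fZ wP.
have wL k := cyclic_isomorphic (wg k).
exists (fun i => #|S i|); split; first exact: dsum_isomorphic dW wL.
exists (fun k => cyclic (w k)); split=> // k; split=> //.
  by apply: cyclic_indecomposable (wg k) _ _; case: (hinT k).
have [g [gg eg eg1]] := orthogonal_complement (tag k) ee e_orth e_sum.
exact: left_ideal_projective eg eg1 (wL k).
Qed.
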